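(* Let $\gamma,a_1,a_2>0$ be real numbers. For the relay feedback system whose plant has transfer function $\dfrac{\gamma}{s^2+a_1s+a_2}$, all trajectories converge to the origin of the state space, i.e. $x(t)\to 0$ as $t\to\infty$.
   Context: The plant is realized in state space by $\dot x=Ax+Bu$, $y=Cx$, $x=(x_1,x_2)^T\in\mathbb{R}^2$, with $$A=\begin{bmatrix}0&-a_2\\1&-a_1\end{bmatrix},\quad B=\begin{bmatrix}\gamma\\0\end{bmatrix},\quad C=\begin{bmatrix}0&1\end{bmatrix}.$$ The relay feedback system is the negative feedback loop $u=-\operatorname{sign}(y)$ with an ideal on-off relay (no hysteresis). A trajectory is a solution on $[0,\infty)$ in the sense of Filippov: an absolutely continuous function $x:[0,\infty)\to\mathbb{R}^2$ satisfying, for almost every $t$, the inclusion $\dot x\in\{Ax-B\}$ if $Cx>0$, $\dot x\in\{Ax+\lambda B:\lambda\in[-1,1]\}$ if $Cx=0$, and $\dot x\in\{Ax+B\}$ if $Cx<0$. *)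

(* Defs.v *)
From HB Require Import structures.
From mathcomp Require Import all_boot all_order all_algebra.
From mathcomp Require Import all_classical all_reals all_analysis.
From mathcomp Require Import ring.

Set Implicit Arguments.
Unset Strict Implicit.
Unset Printing Implicit Defensive.

Import Order.TTheory GRing.Theory Num.Theory.
Import numFieldNormedType.Exports.

Local Open Scope classical_set_scope.
Local Open Scope ring_scope.

Section Plant.
Variable F : fieldType.

Definition plantA (a1 a2 : F) : 'M[F]_2 :=
  \matrix_(i < 2, j < 2) nth 0 (nth [::] [:: [:: 0; - a2];
                                            [:: 1; - a1]] i) j.

Definition plantB (gamma : F) : 'cV[F]_2 := \col_(i < 2) nth 0 [:: gamma; 0] i.

Definition plantC : 'rV[F]_2 := \row_(j < 2) nth 0 [:: 0; 1] j.

Definition transfer_function n (A : 'M[F]_n) (B : 'cV[F]_n) (C : 'rV[F]_n)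
    (s : F) : F :=
  (C *m invmx (s%:M - A) *m B) 0 0.

Lemma plant_transfer_function (gamma a1 a2 s : F) :
  s ^+ 2 + a1 * s + a2 != 0 ->
  transfer_function (plantA a1 a2) (plantB gamma) plantC s
  = gamma / (s ^+ 2 + a1 * s + a2).
Proof.
move=> d0; pose M : 'M[F]_2 := \matrix_(i < 2, j < 2)
  (nth 0 (nth [::] [:: [:: s + a1; - a2]; [:: 1; s]] i) j
   / (s ^+ 2 + a1 * s + a2)).
have M1 : (s%:M - plantA a1 a2) *m M = 1%:M.
  apply/matrixP => -[[|[|//]] ?] [[|[|//]] ?];
  rewrite !mxE !big_ord_recl big_ord0 !mxE /= ?mulr1n ?mulr0n; by field.
have [u _] := mulmx1_unit M1.
have invM : invmx (s%:M - plantA a1 a2) = M by rewrite -[RHS](mulKmx u) M1 mulmx1.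
rewrite /transfer_function invM.
by rewrite !mxE !big_ord_recl big_ord0 !mxE !big_ord_recl !big_ord0 !mxE /=; field.
Qed.

End Plant.

Section RelayFeedback.
Variables (R : realType) (n : nat).

Definition abs_continuous (x : R -> 'cV[R]_n.+1) (a b : R) : Prop :=
  forall e : R, 0 < e -> exists2 d : R, 0 < d &
    forall (m : nat) (p q : 'I_m -> R),
      (forall i, a <= p i /\ p i <= q i /\ q i <= b) ->
      trivIset [set: 'I_m] (fun i => `]p i, q i[%classic) ->
      \sum_(i < m) (q i - p i) < d ->
      \sum_(i < m) `|x (q i) - x (p i)| < e.

Variables (A : 'M[R]_n.+1) (B : 'cV[R]_n.+1) (C : 'rV[R]_n.+1).

Definition relay_inclusion (z : 'cV[R]_n.+1) : set 'cV[R]_n.+1 :=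
  let y := (C *m z) 0 0 in
  if 0 < y then [set A *m z - B]
  else if y < 0 then [set A *m z + B]
  else [set A *m z + l *: B | l in `[-1, 1]].

(* A solution on [0, +oo) is represented by a function on all of R whose values
   at negative times are irrelevant.  Absolute continuity on the unbounded
   interval is understood locally, i.e. on every compact subinterval; the
   two-sided derivative depends on the extension only at t = 0, a null set. *)
Definition relay_trajectory (x : R -> 'cV[R]_n.+1) : Prop :=
  (forall T : R, 0 <= T -> abs_continuous x 0 T) /\
  {ae @lebesgue_measure R, forall t : R, 0 <= t ->
     exists2 v, is_derive t 1 x v & relay_inclusion (x t) v}.

End RelayFeedback.

(* Main.v *)
Require Import Defs.
From mathcomp Require Import all_boot all_order all_algebra.
From mathcomp Require Import all_classical all_reals all_analysis.
From mathcomp Require Import ring lra.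

Set Implicit Arguments.
Unset Strict Implicit.
Unset Printing Implicit Defensive.

Import Order.TTheory GRing.Theory Num.Theory.
Import numFieldNormedType.Exports.

Local Open Scope classical_set_scope.
Local Open Scope ring_scope.

(* With y = x2 and v = y' = x1 - a1 y, the energy v^2/2 + a2 y^2/2 + gamma |y|
   corrected by (a1/2) v y + a1^2 y^2/4 is
     W = (v^2 + x1^2)/4 + a2 y^2/2 + gamma |y|,
   a strict Lyapunov function: almost everywhere
     W' = - (a1/2) (v^2 + a2 y^2 + gamma |y|) <= - c W.
   The selection in the inclusion is harmless: if y = 0 then either v = 0, and
   the term involving it vanishes, or t is an isolated zero of y, and such
   points form a countable set. W o x is absolutely continuous because W is
   locally Lipschitz, so the inequality integrates: W o x is nonincreasing, and
   staying above r > 0 would make it decrease at a uniform rate. *)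

(** * Absolutely continuous functions on a compact interval *)

(** The supremum of the [t] with [Q a t] is itself such a point, and if it were below [b] the local
    hypothesis would move past it. That hypothesis compares [s] only with the centre [t], which is
    what differentiability at [t] provides. *)
Lemma interval_induction (R : realType) (Q : R -> R -> Prop) (a b : R) :
  a <= b ->
  (forall s t u, a <= s -> s <= t -> t <= u -> u <= b ->
     Q s t -> Q t u -> Q s u) ->
  (forall t, a <= t <= b -> exists2 d : R, 0 < d &
     forall s, a <= s <= b -> `|s - t| < d ->
       (s <= t -> Q s t) /\ (t <= s -> Q t s)) ->
  Q a b.
Proof.
move=> ab Qtrans Qloc.
have Qaa : Q a a.
  have [|d d0 /(_ a)] := Qloc a; first by rewrite lexx.
  by rewrite lexx ab subrr normr0 => /(_ isT d0)[]/(_ isT).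
pose S := [set t | a <= t <= b /\ Q a t].
have Sa : S a by split=> //; rewrite lexx.
have Sb : ubound S b by move=> t [/andP[]].
have supS : has_sup S by split; [exists a | exists b].
have ac : a <= sup S by apply: ub_le_sup Sa; exists b.
have cb : sup S <= b by apply: ge_sup => //; exists a.
have [|d d0 loc] := Qloc (sup S); first by rewrite ac.
have Qac : Q a (sup S).
  have [s [/andP[as_ sb] Qas] cs] := sup_adherent d0 supS.
  have sc : s <= sup S.
    apply: ub_le_sup.
    - by exists b.
    - by split=> //; apply/andP.
  apply: (Qtrans _ s) => //.
  have [] := loc s; first by rewrite as_.
    by rewrite ler0_norm ?subr_le0// opprB ltrBlDr -ltrBlDl.
  by move=> + _; apply.
have [/eqP <- //|cNb] := boolP (sup S == b).
have cltb : sup S < b by rewrite lt_neqAle cNb.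
pose s := Num.min b (sup S + d / 2).
have cs : sup S < s by rewrite /s lt_min cltb ltrDl divr_gt0.
have sb : s <= b by rewrite /s ge_min lexx.
have Ss : S s.
  split; first by rewrite sb (le_trans ac (ltW cs)).
  apply: (Qtrans _ (sup S)) => //; first exact: ltW.
  have [] := loc s; first by rewrite sb (le_trans ac (ltW cs)).
    rewrite gtr0_norm ?subr_gt0// ltrBlDl /s gt_min; apply/orP; right.
    by rewrite ltrD2l ltr_pdivrMr// mulr_natr mulr2n ltrDl.
  by move=> _; apply; exact: ltW.
have : s <= sup S by apply: ub_le_sup => //; exists b.
by rewrite leNgt cs.
Qed.

(** Scalar counterpart of [abs_continuous], whose functions take column vectors as values; it is
    meant for [W] composed with a trajectory. *)
Definition abs_continuous_real {R : realType} (f : R -> R) (a b : R) : Prop :=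
  forall e : R, 0 < e -> exists2 d : R, 0 < d &
    forall (m : nat) (p q : 'I_m -> R),
      (forall i, a <= p i /\ p i <= q i /\ q i <= b) ->
      trivIset [set: 'I_m] (fun i => `]p i, q i[%classic) ->
      \sum_(i < m) (q i - p i) < d ->
      \sum_(i < m) `|f (q i) - f (p i)| < e.

Lemma abs_continuous_lipschitz (R : realType) n (x : R -> 'cV[R]_n.+1)
    (f : R -> R) (a b K : R) :
  abs_continuous x a b ->
  (forall s t, a <= s <= b -> a <= t <= b ->
     `|f t - f s| <= K * `|x t - x s|) ->
  abs_continuous_real f a b.
Proof.
move=> acx fx e e0.
(* [K] may be zero or negative, so [e] is divided by [|K| + 1] instead. *)
have K0 : 0 < `|K| + 1 by rewrite ltr_wpDl.
have [|d d0 xd] := acx (e / (`|K| + 1)); first by rewrite divr_gt0.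
exists d => // m p q pq tpq spq.
have := xd m p q pq tpq spq.
rewrite ltr_pdivlMr// mulrC mulr_sumr; apply: le_lt_trans.
apply: ler_sum => i _.
have [? [? ?]] := pq i.
apply: le_trans (fx _ _ _ _) _; try by apply/andP; split=> //; lra.
by rewrite ler_wpM2r// (le_trans (ler_norm K))// lerDl.
Qed.

Lemma sum_disjoint_itv_le (R : realType) m (p q : 'I_m -> R) (U : set R) :
  open U -> (forall i, p i <= q i) ->
  (forall i, `]p i, q i[ `<=` U) ->
  trivIset [set: 'I_m] (fun i => `]p i, q i[%classic) ->
  ((\sum_(i < m) (q i - p i))%:E <= lebesgue_measure U)%E.
Proof.
move=> oU pq pqU tpq.
have mpq (i : 'I_m) : measurable (`]p i, q i[%classic : set R) by [].
have mU : measurable (\big[setU/set0]_(i < m) (`]p i, q i[%classic : set R)).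
  exact: bigsetU_measurable.
have -> : ((\sum_(i < m) (q i - p i))%:E =
    \sum_(i < m) lebesgue_measure (`]p i, q i[%classic : set R))%E.
  rewrite -sumEFin; apply: eq_bigr => i _.
  by rewrite lebesgue_measure_itv/= lte_fin; case: ltgtP (pq i) => // ->;
    rewrite subrr.
rewrite -measure_semi_additive_ord//.
apply: le_measure; rewrite ?inE//.
  exact: measurable_realfun.open_measurable.
by rewrite -bigcup_seq; apply: bigcup_sub => i _; exact: pqU.
Qed.

Lemma is_derive_increment (R : realType) (V : normedModType R) (f : R -> V)
    (t : R) (d : V) (e : R) :
  is_derive t 1 f d -> 0 < e -> exists2 r : R, 0 < r &
    forall s, `|s - t| < r -> `|f s - f t - (s - t) *: d| <= e * `|s - t|.
Proof.
move=> [df <-] e0.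
have /cvgrPdist_le/(_ e e0)[r /= r0 rP] :
  (fun h => h^-1 *: (f (h *: 1 + t) - f t)) @ 0^' --> 'D_1 f t by exact: df.
exists r => // s st.
have [->|sNt] := eqVneq s t.
  by rewrite !subrr scale0r subrr !normr0 mulr0.
have h0 : s - t != 0 by rewrite subr_eq0.
have := rP (s - t); rewrite /= sub0r normrN => /(_ st h0).
rewrite [_ *: 1]mulr1 subrK => ?.
rewrite -normrN opprB -[f s - f t](scalerKV h0) -scalerBr normrZ.
by rewrite mulrC ler_wpM2r.
Qed.

Lemma negligible_open_cover (R : realType) (N : set R) (e : R) :
  (@lebesgue_measure R).-negligible N -> 0 < e ->
  exists U : set R, [/\ open U, N `<=` U & (lebesgue_measure U < e%:E)%E].
Proof.
move=> [A [mA A0 NA]] e0.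
have [|U [oU AU Ue]] := lebesgue_regularity_outer mA _ e0.
  by rewrite [X in (X < _)%E](_ : _ = 0%E).
exists U; split=> //; first exact: subset_trans AU.
rewrite -(setDUK AU) measureU//; last 2 first.
- by apply: measurableD => //; exact: measurable_realfun.open_measurable.
- by rewrite setIDA setIC -setIDA setDv setI0.
by rewrite [X in (X + _)%E](_ : _ = 0%E) ?add0e.
Qed.

(** A mean value inequality obtained without integration. Off a small open set [U] covering the
    exceptional points the derivative controls increments; inside [U] absolute continuity does.
    Interval induction glues the two kinds of pieces. *)
Lemma abs_continuous_increment_le (R : realType) (f : R -> R) (a b k : R) :
  a <= b -> abs_continuous_real f a b ->
  {ae @lebesgue_measure R, forall t, a <= t <= b ->
     exists2 d, is_derive t 1 f d & d <= k} ->
  f b - f a <= k * (b - a).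
Proof.
move=> ab acf dfk.
apply/ler_addgt0Pr => e e0.
set ba := b - a; have ba0 : 0 <= ba by rewrite subr_ge0.
(* The error [e] is split into [e' * ba] from the points of differentiability, one [e'] from the
   increments of [f] inside [U], and one [e'] from the linear term [k * u] there. *)
pose e' := e / (ba + 2).
have e'0 : 0 < e' by rewrite divr_gt0// ltr_wpDl.
have [d d0 fd] := acf _ e'0.
pose g u := f u - k * u.
have k0 : 0 < `|k| + 1 by rewrite ltr_wpDl.
(* The first bound activates the absolute continuity of [f]; the second keeps [|k|] times the total
   length below [e']. *)
pose d' := Num.min d (e' / (`|k| + 1)).
have d'0 : 0 < d' by rewrite lt_min d0 divr_gt0.
have [U [oU NU Ud]] := negligible_open_cover dfk d'0.
(* The increments of g over finitely many disjoint intervals inside the open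
   cover U of the null set are small by absolute continuity. *)
pose Q s t := exists (m : nat) (p q : 'I_m -> R),
  [/\ forall i, s <= p i /\ p i <= q i /\ q i <= t,
      forall i, `]p i, q i[ `<=` U,
      trivIset [set: 'I_m] (fun i => `]p i, q i[%classic) &
      g t - g s <= e' * (t - s) + \sum_(i < m) (g (q i) - g (p i))].
have : Q a b.
  apply: interval_induction => //.
    (* The two families are concatenated over ['I_(m + m')]; intervals from different families are
       disjoint because they lie on opposite sides of [t]. *)
    move=> s t u _ st tu _ [m [p [q [pq pqU tpq fst]]]].
    move=> [m' [p' [q' [pq' pqU' tpq' ftu]]]].
    exists (m + m')%N.
    exists (fun i : 'I_(m + m') =>
      match fintype.split i with inl i => p i | inr i => p' i end).
    exists (fun i : 'I_(m + m') =>
      match fintype.split i with inl i => q i | inr i => q' i end).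
    split.
    - move=> i; case: fintype.split => j.
        by have := pq j; lra.
      by have := pq' j; lra.
    - by move=> i; case: fintype.split.
    - move=> i j _ _ [z /= zij]; rewrite -(splitK i) -(splitK j); move: zij.
      case: (fintype.split i) => i'; case: (fintype.split j) => j' [].
      + by move=> zi zj; rewrite (tpq i' j') => //; exists z.
      + rewrite /= !in_itv/= => /andP[? ?] /andP[? ?].
        by exfalso; have := pq i'; have := pq' j'; lra.
      + rewrite /= !in_itv/= => /andP[? ?] /andP[? ?].
        by exfalso; have := pq' i'; have := pq j'; lra.
      + by move=> zi zj; rewrite (tpq' i' j') => //; exists z.
    - rewrite big_split_ord/=.
      under eq_bigr do rewrite (unsplitK (inl _)).
      under [X in _ <= _ + (_ + X)]eq_bigr do rewrite (unsplitK (inr _)).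
      by lra.
  move=> t tab.
  have [tU|tNU] := pselect (U t).
    (* Near a point of [U] the interval between [s] and [t] is itself the family, so its increment
       of [g] is charged in full. *)
    have [r r0 rU] := (nbhs_ballP _ _).1 (oU t tU).
    exists r => // s sab st.
    have sub u v : u <= v -> `|u - t| < r -> `|v - t| < r -> Q u v.
      move=> uv ut vt; exists 1%N, (fun=> u), (fun=> v); split.
      - by move=> _; rewrite lexx.
      - move=> _ z /=; rewrite in_itv/= => /andP[uz zv].
        apply: rU; rewrite /ball/= distrC.
        by move: ut vt; rewrite !ltr_norml => /andP[? ?] /andP[? ?]; lra.
      - by move=> i j _ _ _; rewrite !ord1.
      - by rewrite big_ord1 lerDr mulr_ge0 ?subr_ge0// ltW.
    by split=> ?; apply: sub; rewrite ?subrr ?normr0.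
  have [df fdf dk] : exists2 d, is_derive t 1 f d & d <= k.
    by apply: contrapT => Nd; apply: tNU; apply: NU => /= /(_ tab).
  have [r r0 rf] := is_derive_increment fdf e'0.
  exists r => // s sab st; have := rf s st; rewrite ler_norml => /andP[lo up].
  (* Outside [U] the family is empty: the derivative bound alone gives an increment of [g] of at
     most [e'] times the length. *)
  split=> ts; exists 0%N, (fun=> 0), (fun=> 0); split=> //; try by case.
  - rewrite big_ord0 addr0 /g.
    move: lo; rewrite ler0_norm ?subr_le0// /GRing.scale/= => lo.
    have : (t - s) * df <= (t - s) * k by rewrite ler_wpM2l// subr_ge0.
    by lra.
  - rewrite big_ord0 addr0 /g.
    move: up; rewrite ger0_norm ?subr_ge0// /GRing.scale/= => up.
    have : (s - t) * df <= (s - t) * k by rewrite ler_wpM2l// subr_ge0.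
    by lra.
move=> [m [p [q [pq pqU tpq]]]].
have spq : \sum_(i < m) (q i - p i) < d'.
  rewrite -lte_fin; apply: le_lt_trans Ud.
  by apply: sum_disjoint_itv_le => // i; have [_ []] := pq i.
have fpq : \sum_(i < m) `|f (q i) - f (p i)| < e'.
  by apply: fd => //; apply: lt_le_trans spq _; rewrite /d' ge_min lexx.
have kpq : `|k| * \sum_(i < m) (q i - p i) <= e'.
  have spq' : \sum_(i < m) (q i - p i) <= e' / (`|k| + 1).
    by apply: le_trans (ltW spq) _; rewrite /d' ge_min lexx orbT.
  apply: (@le_trans _ _ (`|k| * (e' / (`|k| + 1)))); first exact: ler_wpM2l.
  rewrite mulrCA ler_piMr ?ltW// ltr_pdivrMr// mul1r ltrDl ltr01//.
have : \sum_(i < m) (g (q i) - g (p i)) <=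
    \sum_(i < m) `|f (q i) - f (p i)| + `|k| * \sum_(i < m) (q i - p i).
  rewrite mulr_sumr -big_split/=; apply: ler_sum => i _.
  have [_ [pqi _]] := pq i.
  have := ler_norm (f (q i) - f (p i)).
  have : - `|k| * (q i - p i) <= k * (q i - p i).
    by rewrite ler_wpM2r ?subr_ge0// lerNl -normrN ler_norm.
  by rewrite /g; lra.
have : e = e' * (ba + 2) by rewrite /e' divfK// gt_eqF// ltr_wpDl.
by rewrite /g /ba; lra.
Qed.

(** Tolerance 1 gives a [d] such that [x] varies by less than 1 over any interval shorter than [d];
    interval induction joins these local bounds. *)
Lemma abs_continuous_bounded (R : realType) n (x : R -> 'cV[R]_n.+1) (a b : R) :
  a <= b -> abs_continuous x a b ->
  exists M : R, forall t, a <= t <= b -> `|x t| <= M.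
Proof.
move=> ab acx.
have [d d0 xd] := acx 1 ltr01.
pose Q s t := exists M : R, forall u, s <= u <= t -> `|x u| <= M.
apply: (@interval_induction _ Q) => //.
  move=> s t u _ st tu _ [M HM] [M' HM']; exists (Num.max M M').
    move=> r /andP[sr ru].
  rewrite le_max; have [rt|/ltW tr] := leP r t.
    by rewrite HM ?sr.
  by rewrite HM' ?tr ?orbT.
move=> t /andP[at_ tb]; exists d => // s /andP[as_ sb] st.
have near u v : a <= u -> u <= v -> v <= b -> v - u < d -> `|x v - x u| < 1.
  move=> au uv vb uvd.
  have := xd 1%N (fun=> u) (fun=> v); rewrite !big_ord1; apply=> //.
  by move=> i j _ _ _; rewrite !ord1.
move: st; rewrite ltr_norml => /andP[? ?].
split=> ts; exists (1 + `|x t|) => u /andP[? ?].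
- rewrite -lerBlDr (le_trans (lerB_dist _ _))// distrC ltW//.
  by apply: near => //; lra.
- rewrite -lerBlDr (le_trans (lerB_dist _ _))// ltW//.
  by apply: near => //; lra.
Qed.

(** * Derivatives of entries and of absolute values *)

Lemma ler_entry_norm (R : realType) m n (z : 'M[R]_(m.+1, n.+1)) i j :
  `|z i j| <= `|z|.
Proof.
rewrite [leRHS]/Num.Def.normr/= mx_normrE.
exact: (@le_bigmax _ _ _ _ (fun ij => `|z ij.1 ij.2|) (i, j)).
Qed.

Lemma is_derive_entry (R : realType) m n (x : R -> 'M[R]_(m.+1, n.+1)) (t : R)
    (v : 'M[R]_(m.+1, n.+1)) i j :
  is_derive t 1 x v -> is_derive t 1 (fun s => x s i j) (v i j).
Proof.
move=> [xt <-]; rewrite derive_mx// mxE.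
by apply: derivableP; apply: (derivable_mxP _ _ _).1.
Qed.

(** A second zero [s] near [t] would make the linear term [(s - t) * v] as small as half its own
    absolute value, forcing [s = t]. *)
Lemma isolated_zero (R : realType) (y : R -> R) (t v : R) :
  is_derive t 1 y v -> y t = 0 -> v != 0 -> isolated [set s | y s = 0] t.
Proof.
move=> yv yt v0.
have v2 : 0 < `|v| / 2 by rewrite divr_gt0// normr_gt0.
have [r r0 yr] := is_derive_increment yv v2.
split; first exact: mem_set.
exists (ball t r); first exact: nbhsx_ballx.
apply/seteqP; split=> s /=; last by move=> ->; split=> //; exact: ballxx.
move=> []; rewrite /ball/= distrC => ts ys.
have := yr s ts; rewrite ys yt subrr sub0r normrN normrZ mulrC => h.
apply/eqP; rewrite -subr_eq0 -normr_le0.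
have : `|s - t| * (`|v| / 2) <= 0 by lra.
by rewrite pmulr_lle0.
Qed.

(** Where [y t] is nonzero, [l] is minus its sign. At a zero the derivative of [y] vanishes, and the
    difference quotients of [|y|] have the same absolute values as those of [y], so the formula
    gives 0 for any [l]. *)
Lemma is_derive_norm (R : realType) (y : R -> R) (t v l : R) :
  is_derive t 1 y v -> l * y t = - `|y t| -> (y t = 0 -> v = 0) ->
  is_derive t 1 (fun s => `|y s|) (- l * v).
Proof.
move=> yv ly y0v.
have cy : y @ t --> y t.
  by apply/differentiable_continuous/derivable1_diffP; case: yv.
case: (ltgtP (y t) 0) => yt.
- have -> : - l * v = - v.
    suff -> : l = 1 by lra.
    by apply: (mulIf (ltr0_neq0 yt)); rewrite ly ltr0_norm// opprK mul1r.
  apply: near_eq_is_derive (is_deriveN yv).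
  near=> s; rewrite /= [RHS]ler0_norm//.
  by near: s; move: yt => /(cvgr_lt _ cy); apply: filterS => s /ltW.
- have -> : - l * v = v.
    suff -> : l = -1 by lra.
    by apply: (mulIf (lt0r_neq0 yt)); rewrite ly gtr0_norm// mulN1r.
  apply: near_eq_is_derive yv.
  near=> s; rewrite /= ger0_norm//.
  by near: s; move: yt => /(cvgr_gt _ cy); apply: filterS => s /ltW.
- rewrite (y0v yt) mulr0.
  move: yv; rewrite (y0v yt) => yv.
  have h : (fun h => h^-1 *: (`|y (h *: 1 + t)| - `|y t|)) @ 0^' --> (0 : R).
    have := yv; case=> /= yd y0.
    have : (fun h => h^-1 *: (y (h *: 1 + t) - y t)) @ 0^' --> (0 : R).
      by rewrite -{2}y0; exact: yd.
    rewrite yt !normr0; move=> /cvgrPdist_le H.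
    apply/cvgrPdist_le => e e0; have := H e e0.
    apply: filterS => r; rewrite !sub0r !subr0 !normrN !normrZ normr_id.
    by [].
  split; first by apply/cvg_ex; exists 0.
  exact: cvg_lim.
Unshelve. all: by end_near. Qed.

(** * The relay inclusion in coordinates *)

(** Here [l] is the relay output. The equation [l * z 1 0 = - |z 1 0|] treats the three cases
    uniformly: it says [l = - sign y] off the switching line and holds for every selection on it. *)
Lemma relay_plant_inclusion (R : realType) (gamma a1 a2 : R) (z v : 'cV[R]_2) :
  relay_inclusion (plantA a1 a2) (plantB gamma) (plantC R) z v ->
  v 1 0 = z 0 0 - a1 * z 1 0 /\
  exists2 l, v 0 0 = - a2 * z 1 0 + gamma * l & l * z 1 0 = - `|z 1 0|.
Proof.
have Cz : (plantC R *m z) 0 0 = z 1 0.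
  rewrite mxE !big_ord_recl big_ord0 !mxE/= mul0r mul1r add0r addr0.
  by congr (z _ _); apply: val_inj.
have Az0 : (plantA a1 a2 *m z) 0 0 = - a2 * z 1 0.
  rewrite mxE !big_ord_recl big_ord0 !mxE/= mul0r add0r addr0.
  by congr (_ * z _ _); apply: val_inj.
have Az1 : (plantA a1 a2 *m z) 1 0 = z 0 0 - a1 * z 1 0.
  rewrite mxE !big_ord_recl big_ord0 !mxE/= mul1r addr0 mulNr.
  by congr (z _ _ - _ * z _ _); apply: val_inj.
have key l : l * z 1 0 = - `|z 1 0| ->
    v = plantA a1 a2 *m z + l *: plantB gamma ->
    v 1 0 = z 0 0 - a1 * z 1 0 /\
    exists2 l, v 0 0 = - a2 * z 1 0 + gamma * l & l * z 1 0 = - `|z 1 0|.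
  move=> lz ->; split; [|exists l => //]; rewrite mxE ?Az0 ?Az1 !mxE/=.
    by rewrite mulr0 addr0.
  by rewrite (mulrC l).
rewrite /relay_inclusion Cz.
case: (ltgtP 0 (z 1 0)) => z1 /=.
- by move=> vE; apply: (key (-1)); rewrite ?scaleN1r// mulN1r gtr0_norm.
- by move=> vE; apply: (key 1); rewrite ?scale1r// mul1r ltr0_norm// opprK.
- by move=> [l _ lE]; apply: (key l) => //; rewrite -z1 mulr0 normr0 oppr0.
Qed.

(** The isolated points of any set of reals are countable, hence null. Applied to the zeros of [y],
    this discards the instants at which [y] vanishes with nonzero velocity. *)
Lemma ae_not_isolated (R : realType) (A : set R) :
  {ae @lebesgue_measure R, forall t, ~ isolated A t}.
Proof.
exists (isolated A); split.
- exact: countable_measurable (countable_isolated A).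
- exact: countable_lebesgue_measure0 (countable_isolated A).
- by move=> t /= /contrapT.
Qed.

(** * The Lyapunov function and its dissipation *)

Definition lyapunov {R : realType} (gamma a1 a2 : R) (z : 'cV[R]_2) : R :=
  4^-1 * ((z 0 0 - a1 * z 1 0) ^+ 2 + z 0 0 ^+ 2) + a2 / 2 * z 1 0 ^+ 2
  + gamma * `|z 1 0|.

Definition dissipation {R : realType} (gamma a1 a2 : R) (z : 'cV[R]_2) : R :=
  (z 0 0 - a1 * z 1 0) ^+ 2 + a2 * z 1 0 ^+ 2 + gamma * `|z 1 0|.

Lemma sqr_lipschitz (R : realType) (M s t : R) :
  `|s| <= M -> `|t| <= M -> `|t ^+ 2 - s ^+ 2| <= M *+ 2 * `|t - s|.
Proof.
move=> sM tM; rewrite subr_sqr mulrC normrM ler_wpM2r//.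
by rewrite (le_trans (ler_normD _ _))// mulr2n lerD.
Qed.

Section Lyapunov.
Variables (R : realType) (gamma a1 a2 : R).
Hypotheses (gamma0 : 0 < gamma) (a10 : 0 < a1) (a20 : 0 < a2).

Local Notation W := (lyapunov gamma a1 a2).

Lemma lyapunov_lipschitz (M : R) : exists K, forall z w,
  `|z| <= M -> `|w| <= M -> `|W w - W z| <= K * `|w - z|.
Proof.
(* [L] bounds [|z 0 0 - a1 * z 1 0|] when [|z| <= M], the norm being the maximum of the entries.
   Each square contributes twice its bound times its own Lipschitz constant. *)
pose L := (1 + a1) * M.
exists (4^-1 * (L *+ 2 * (1 + a1) + M *+ 2) + a2 / 2 * (M *+ 2)
  + gamma) => z w zM wM.
have D i : `|w i 0 - z i 0| <= `|w - z|.
  by have := ler_entry_norm (w - z) i 0; rewrite !mxE.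
have zi i : `|z i 0| <= M by exact: le_trans (ler_entry_norm z i 0) zM.
have wi i : `|w i 0| <= M by exact: le_trans (ler_entry_norm w i 0) wM.
have M0 : 0 <= M by exact: le_trans zM.
have comb (p q N : R) : `|p| <= N -> `|q| <= N -> `|p - a1 * q| <= (1 + a1) * N.
  move=> pN qN; rewrite (le_trans (ler_normB _ _))// mulrDl mul1r lerD//.
  by rewrite normrM gtr0_norm// ler_wpM2l// ltW.
have Dv : `|(w 0 0 - a1 * w 1 0) - (z 0 0 - a1 * z 1 0)| <= (1 + a1) * `|w - z|.
  rewrite (_ : _ - _ = (w 0 0 - z 0 0) - a1 * (w 1 0 - z 1 0)); last by ring.
  exact: comb.
have L0 : 0 <= L *+ 2 by rewrite mulrn_wge0// mulr_ge0// addr_ge0// ltW.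
have M20 : 0 <= M *+ 2 by rewrite mulrn_wge0.
have h1 : `|(w 0 0 - a1 * w 1 0) ^+ 2 - (z 0 0 - a1 * z 1 0) ^+ 2| <=
    L *+ 2 * (1 + a1) * `|w - z|.
  rewrite -mulrA; apply: le_trans (ler_wpM2l L0 Dv).
  by apply: sqr_lipschitz; exact: comb.
have h2 i : `|w i 0 ^+ 2 - z i 0 ^+ 2| <= M *+ 2 * `|w - z|.
  by apply: le_trans (ler_wpM2l M20 (D i)); exact: sqr_lipschitz.
have h3 : `| `|w 1 0| - `|z 1 0| | <= `|w - z| :=
  le_trans (ler_dist_dist _ _) (D 1).
have h4 := ler_wpM2l (ltW a20) (h2 1).
have h5 := ler_wpM2l (ltW gamma0) h3.
rewrite /lyapunov.
set A := `|w - z| in h1 h2 h3 h4 h5 *.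
set L2 := L *+ 2 * _ in h1 *; set M2 := M *+ 2 in h2 h4 *.
rewrite (_ : _ - _ = 4^-1 * (
  ((w 0 0 - a1 * w 1 0) ^+ 2 - (z 0 0 - a1 * z 1 0) ^+ 2)
  + (w 0 0 ^+ 2 - z 0 0 ^+ 2)) + a2 / 2 * (w 1 0 ^+ 2 - z 1 0 ^+ 2)
  + gamma * (`|w 1 0| - `|z 1 0|)); last by field.
rewrite !mulrDl (le_trans (ler_normD _ _))// lerD//; last first.
  by rewrite normrM gtr0_norm.
rewrite (le_trans (ler_normD _ _))// lerD//.
  rewrite normrM gtr0_norm ?invr_gt0// -mulrA ler_wpM2l ?invr_ge0//.
  rewrite (le_trans (ler_normD _ _))// mulrDl lerD//; exact: h2.
by rewrite normrM gtr0_norm ?divr_gt0// -[leRHS]mulrA ler_wpM2l//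
  ltW// divr_gt0.
Qed.

(** With [v] the derivative of [y], the term [gamma * l * v] coming from the squares cancels the
    derivative of [gamma * |y|], and the terms [a2 * y * v] cancel as well. The selection survives
    only in [l * y], which is [- |y|]. *)
Lemma lyapunov_derive (x : R -> 'cV[R]_2) (t : R) (v : 'cV[R]_2) :
  is_derive t 1 x v ->
  relay_inclusion (plantA a1 a2) (plantB gamma) (plantC R) (x t) v ->
  ~ isolated [set s | x s 1 0 = 0] t ->
  is_derive t 1 (W \o x) (- (a1 / 2) * dissipation gamma a1 a2 (x t)).
Proof.
move=> xv /relay_plant_inclusion[v1 [l v0 lx]] Niso.
have d0 := is_derive_entry 0 0 xv.
have d1 := is_derive_entry 1 0 xv.
have dn : is_derive t 1 (fun s => `|x s 1 0|) (- l * v 1 0).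
  apply: (is_derive_norm d1 lx) => x10; apply: contrapT => /eqP v10.
  by apply: Niso; exact: isolated_zero d1 x10 v10.
pose x0 s := x s 0 0; pose x1 s := x s 1 0; pose n s := `|x s 1 0|.
(* Written as an algebraic combination of functions, [W \o x] is differentiated by instance
   resolution; the hypotheses are then restated for [x0], [x1] and [n] so that they are found. *)
have -> : W \o x = 4^-1 \*: ((x0 - a1 \*: x1) ^+ 2 + x0 ^+ 2)
    + (a2 / 2) \*: (x1 ^+ 2) + gamma \*: n.
  by apply/funext => s.
have {}d0 : is_derive t 1 x0 (v 0 0) := d0.
have {}d1 : is_derive t 1 x1 (v 1 0) := d1.
have {}dn : is_derive t 1 n (- l * v 1 0) := dn.
apply: is_derive_eq.
rewrite /dissipation.
have -> : `|x t 1 0| = - (l * x t 1 0) by rewrite lx opprK.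
rewrite (_ : (x0 - a1 \*: x1) t = x t 0 0 - a1 * x t 1 0)//.
by rewrite v1 v0 /x0 /x1 /GRing.scale/= !expr1; field.
Qed.

(** Expanding [(v + a1 * y) ^+ 2] and bounding the cross term by [(v - a1 * y) ^+ 2 >= 0] leaves at
    most [a1 ^+ 2 * y ^+ 2 / 2], which is [a1 ^+ 2 / (2 * a2)] times [a2 * y ^+ 2]. *)
Lemma lyapunov_le_dissipation (z : 'cV[R]_2) :
  W z <= (1 + a1 ^+ 2 / (2 * a2)) * dissipation gamma a1 a2 z.
Proof.
rewrite /lyapunov /dissipation.
set v := z 0 0 - _; have -> : z 0 0 = v + a1 * z 1 0 by rewrite /v; ring.
set y := z 1 0.
have y0 : 0 <= gamma * `|y| by rewrite mulr_ge0// ltW.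
have k0 : 0 <= a1 ^+ 2 / (2 * a2).
  by rewrite divr_ge0// ?sqr_ge0// mulr_ge0// ltW.
have E : a1 ^+ 2 * y ^+ 2 = 2 * (a1 ^+ 2 / (2 * a2) * (a2 * y ^+ 2)).
  by field; rewrite gt_eqF.
have := mulr_ge0 k0 y0.
have := mulr_ge0 k0 (sqr_ge0 v).
have := sqr_ge0 (v - a1 * y).
have := sqr_ge0 v.
have : 0 <= a2 * y ^+ 2 by rewrite mulr_ge0// ?sqr_ge0// ltW.
lra.
Qed.


Lemma lyapunov_ge0 (z : 'cV[R]_2) : 0 <= W z.
Proof.
have a2_ge0 : 0 <= a2 / 2 by rewrite divr_ge0// ltW.
by rewrite /lyapunov !addr_ge0// mulr_ge0 ?addr_ge0 ?sqr_ge0 ?invr_ge0// ltW.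
Qed.

Lemma dissipation_ge0 (z : 'cV[R]_2) : 0 <= dissipation gamma a1 a2 z.
Proof.
by rewrite /dissipation !addr_ge0 ?sqr_ge0// mulr_ge0 ?sqr_ge0// ltW.
Qed.

Lemma lyapunov_small (e : R) : 0 < e ->
  exists2 r, 0 < r & forall z, W z < r -> `|z| < e.
Proof.
(* Since [W] dominates both [z 0 0 ^+ 2 / 4] and [gamma * |z 1 0|], each bound controls one
   entry. *)
move=> e0; exists (Num.min (e ^+ 2 / 4) (gamma * e)).
  by rewrite lt_min divr_gt0 ?exprn_gt0// mulr_gt0.
move=> z; rewrite lt_min => /andP[z0 z1].
have h0 : 0 <= (z 0 0 - a1 * z 1 0) ^+ 2 := sqr_ge0 _.
have h0' : 0 <= z 0 0 ^+ 2 := sqr_ge0 _.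
have h1 : 0 <= a2 / 2 * z 1 0 ^+ 2.
  by rewrite mulr_ge0 ?sqr_ge0// divr_ge0// ltW.
have h2 : 0 <= gamma * `|z 1 0| by rewrite mulr_ge0// ltW.
move: z0 z1; rewrite /lyapunov => z0 z1.
rewrite [ltLHS]/Num.Def.normr/= mx_normrE.
apply: bigmax_lt => //= -[i j] _ /=; rewrite (ord1 j).
have [->|->] : i = 0 \/ i = 1.
  by case: i => -[|[|//]] ?; [left|right]; apply: val_inj.
- rewrite -(ltr_pXn2r (n := 2))// ?nnegrE ?ltW// real_normK ?num_real//; lra.
- by rewrite -(ltr_pM2l gamma0); lra.
Qed.

(** * Decay along a trajectory *)

Variable x : R -> 'cV[R]_2.
Hypothesis x_traj : relay_trajectory (plantA a1 a2) (plantB gamma) (plantC R) x.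

(** The free bound [k] serves twice: [k = 0] gives monotonicity, and a positive [k] a uniform rate
    of decrease. *)
Lemma lyapunov_decrease (s t k : R) : 0 <= s -> s <= t ->
  (forall u, s <= u <= t -> k <= dissipation gamma a1 a2 (x u)) ->
  W (x t) - W (x s) <= - (a1 / 2 * k) * (t - s).
Proof.
move=> s0 st kd; case: x_traj => acx aex.
have acst : abs_continuous x s t.
  move=> e e0; have [d d0 xd] := acx t (le_trans s0 st) e e0.
  by exists d => // m p q pq; apply: xd => i; have := pq i; lra.
apply: (@abs_continuous_increment_le _ (W \o x)) => //.
  have [M xM] := abs_continuous_bounded st acst.
  have [K WK] := lyapunov_lipschitz M.
  by apply: (abs_continuous_lipschitz acst (K := K)) => u v /xM ? /xM ?;
    exact: WK.
apply: (@filterS2 _ _ (ae_filter_ringOfSetsType (@lebesgue_measure R))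
  _ _ _ _ aex (ae_not_isolated [set u | x u 1 0 = 0])) => u + uiso sut.
have u0 : 0 <= u by case/andP: sut => + _; exact: le_trans.
move=> /(_ u0)[v xv vincl].
exists (- (a1 / 2) * dissipation gamma a1 a2 (x u)).
  exact: lyapunov_derive xv vincl uiso.
by rewrite mulNr lerN2 ler_wpM2l ?kd// divr_ge0// ltW.
Qed.

Lemma lyapunov_eventually_lt (r : R) : 0 < r ->
  exists T : R, forall t, T < t -> W (x t) < r.
Proof.
move=> r0.
pose K := 1 + a1 ^+ 2 / (2 * a2).
have K0 : 0 < K by rewrite ltr_pwDl// divr_ge0 ?sqr_ge0// mulr_ge0// ltW.
pose c := a1 / 2 * (r / K).
have c0 : 0 < c by rewrite mulr_gt0 ?divr_gt0.
(* After time [W (x 0) / c], a decrease at rate [c] would have made [W] negative. *)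
exists (Num.max 0 (W (x 0) / c)) => t; rewrite gt_max => /andP[t0 Tt].
rewrite ltNge; apply/negP => rt.
have : W (x t) - W (x 0) <= - c * (t - 0).
  apply: lyapunov_decrease; rewrite ?(ltW t0)// => u /andP[u0 ut].
  rewrite ler_pdivrMr// mulrC; apply: le_trans (lyapunov_le_dissipation (x u)).
  (* By monotonicity [W (x u) >= W (x t) >= r] for all earlier [u], so the dissipation is at least
     [r / K] on the whole of [[0, t]]. *)
  apply: le_trans rt _; rewrite -subr_le0.
  apply: le_trans (@lyapunov_decrease u t 0 u0 ut _) _.
    by move=> ? _; exact: dissipation_ge0.
  by rewrite mulr0 oppr0 mul0r.
move: Tt; rewrite ltr_pdivrMr// => Tt.
by have := lyapunov_ge0 (x t); lra.
Qed.

End Lyapunov.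

Theorem mainTheorem2 (R : realType) (gamma a1 a2 : R)
    (gamma_gt0 : 0 < gamma) (a1_gt0 : 0 < a1) (a2_gt0 : 0 < a2)
    (x : R -> 'cV[R]_2)
    (x_traj : relay_trajectory (plantA a1 a2) (plantB gamma) (plantC R) x) :
  x t @[t --> +oo] --> (0 : 'cV[R]_2).
Proof.
apply/cvgrPdist_lt => e e0.
have [r r0 small] := lyapunov_small a1 gamma_gt0 a2_gt0 e0.
have [T WT] := lyapunov_eventually_lt gamma_gt0 a1_gt0 a2_gt0 x_traj r0.
exists T; split; first exact: num_real.
by move=> t Tt; rewrite sub0r normrN; apply/small/WT.
Qed.
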